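(* There is an absolute constant $c>0$ such that the following holds. Let $\mathcal{C}$ be a class of functions $\{\pm1\}^d\to\{\pm1\}$, $\mathcal{V}\subseteq2^{[d]}$ a nonempty collection of subsets of features, $\varepsilon\in(0,1/2)$, $\delta\in(0,1)$, and let $n,m\in\mathbb{N}$ satisfy $$m\ \ge\ c\,\mathrm{VC}(\mathcal{C}\mid\mathcal{V})\frac{\log(1/\varepsilon)}{\varepsilon},\qquad nm\ \ge\ c\,\frac{\log|\mathcal{V}|+\log(1/\delta)}{\varepsilon}.$$ Then $\delta_{\mathrm{gen}}(\mathcal{C},\mathcal{V},n,m,\varepsilon)\le\delta$.
   Context: For $f:\{\pm1\}^d\to\{\pm1\}$, $\mathrm{Rel}(f)=\{j\in[d]:\exists v\in\{\pm1\}^d,\ f(v|_{v_j=+1})\neq f(v|_{v_j=-1})\}$, where $v|_{v_j=b}$ is $v$ with coordinate $j$ set to $b$. For $V\subseteq[d]$, $(\mathcal{C}\mid V)=\{f\in\mathcal{C}:\mathrm{Rel}(f)\subseteq V\}$, and $\mathrm{VC}(\mathcal{C}\mid\mathcal{V})=\max_{V\in\mathcal{V}}\mathrm{VC}(\mathcal{C}\mid V)$, where $\mathrm{VC}$ is the usual Vapnik–Chervonenkis dimension. For distributions $D^{(1)},\dots,D^{(n)}$ over $\{\pm1\}^d\times\{\pm1\}$, $\delta_{\mathrm{gen}}(\mathcal{C},\mathcal{V},n,m,\varepsilon,D^{(1)},\dots,D^{(n)})$ is the probability, over independent samples $S^{(i)}\sim(D^{(i)})^m$, $i\in[n]$, that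 there exist $h^{(1)},\dots,h^{(n)}\in\mathcal{C}$ with $\bigcup_i\mathrm{Rel}(h^{(i)})\in\mathcal{V}$ such that $\frac{1}{nm}\sum_{i}\sum_{(x,y)\in S^{(i)}}\mathbf{1}[h^{(i)}(x)\neq y]\le\varepsilon$ but $\frac1n\sum_i\Pr_{(x,y)\sim D^{(i)}}[h^{(i)}(x)\neq y]\ge4\varepsilon$. Then $\delta_{\mathrm{gen}}(\mathcal{C},\mathcal{V},n,m,\varepsilon)$ is the supremum of this quantity over all choices of $D^{(1)},\dots,D^{(n)}$. *)

(* Defs.v *)
From Stdlib Require Import Rdefinitions Rpower.
From HB Require Import structures.
From mathcomp Require Import all_boot all_order all_algebra.
From mathcomp Require Import Rstruct.
Set Implicit Arguments. Unset Strict Implicit. Unset Printing Implicit Defensive.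
Import Order.TTheory GRing.Theory Num.Theory.
Local Open Scope ring_scope.

(* {+-1}^d is encoded as {ffun 'I_d -> bool} (true = +1, false = -1);
   labels {+-1} are encoded as bool. *)
Definition point (d : nat) := {ffun 'I_d -> bool}.
Definition hyp (d : nat) := {ffun point d -> bool}.

Definition setcoord d (v : point d) (j : 'I_d) (b : bool) : point d :=
  [ffun k => if k == j then b else v k].

Definition Rel d (f : hyp d) : {set 'I_d} :=
  [set j | [exists v : point d, f (setcoord v j true) != f (setcoord v j false)]].

Definition restrictC d (C : {set hyp d}) (V : {set 'I_d}) : {set hyp d} :=
  [set f in C | Rel f \subset V].

Definition shatters (T : finType) (H : {set {ffun T -> bool}}) (A : {set T}) : bool :=
  [forall B in powerset A, [exists h in H, [forall x in A, h x == (x \in B)]]].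

Definition VC (T : finType) (H : {set {ffun T -> bool}}) : nat :=
  \max_(A : {set T} | shatters H A) #|A|.

Definition VCcond d (C : {set hyp d}) (calV : {set {set 'I_d}}) : nat :=
  \max_(V in calV) VC (restrictC C V).

Definition is_distr d (D : {ffun (point d * bool) -> R}) : Prop :=
  (forall z, 0 <= D z) /\ \sum_z D z = 1.

(* one sample set per task: S i j is the j-th example of task i *)
Definition samples d n m := {ffun 'I_n -> {ffun 'I_m -> (point d * bool)}}.

Definition sample_prob d n m (D : 'I_n -> {ffun (point d * bool) -> R})
  (S : samples d n m) : R :=
  \prod_(i < n) \prod_(j < m) D i (S i j).

Definition emp_err d n m (h : 'I_n -> hyp d) (S : samples d n m) : R :=
  (n * m)%:R^-1 * \sum_(i < n) \sum_(j < m) (h i (S i j).1 != (S i j).2)%:R.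

Definition true_err d n (D : 'I_n -> {ffun (point d * bool) -> R})
  (h : 'I_n -> hyp d) : R :=
  n%:R^-1 * \sum_(i < n) \sum_(z : point d * bool) D i z * (h i z.1 != z.2)%:R.

Definition bad_event d n m (C : {set hyp d}) (calV : {set {set 'I_d}}) (eps : R)
  (D : 'I_n -> {ffun (point d * bool) -> R}) (S : samples d n m) : bool :=
  [exists h : {ffun 'I_n -> hyp d},
    [&& [forall i, h i \in C], (\bigcup_(i < n) Rel (h i)) \in calV,
        emp_err h S <= eps & 4 * eps <= true_err D h]].

Definition delta_gen_D d n m (C : {set hyp d}) (calV : {set {set 'I_d}}) (eps : R)
  (D : 'I_n -> {ffun (point d * bool) -> R}) : R :=
  \sum_(S : samples d n m | bad_event C calV eps D S) sample_prob D S.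

(* Main.v *)
Require Import Defs.
From Stdlib Require Import Rdefinitions Rpower Rtrigo_def Exp_prop.
From HB Require Import structures.
From mathcomp Require Import all_boot all_order all_algebra.
From mathcomp Require Import Rstruct lra zify.
Set Implicit Arguments. Unset Strict Implicit. Unset Printing Implicit Defensive.
Import Order.TTheory GRing.Theory Num.Theory.
Local Open Scope ring_scope.
(* Otherwise arguments of type [R] are read in Stdlib's real scope. *)
Local Arguments exp x%_R.
Bind Scope ring_scope with R.

(** For a sample pair (s, s') of one task, weight a hypothesis h by
    (1/2)^(errors on s) (3/2)^(errors on s').  Swapping s_j and s'_j at random
    averages this weight to at most 1, since (1/2 + 3/2) / 2 = 1 and
    (1/2)(3/2) <= 1; hence the expected sum of the weights over all error patterns
    is at most the number of patterns, which Pajor's form of the Sauer-Shelah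
    lemma bounds by x^-k (1+x)^(2m) for every x in (0,1].  In the other direction,
    a bad s carries a tuple h whose weight, averaged over s', is at least
    exp(-errors + m sum_i err_i / 3) >= exp(eps n m / 3).  Tasks are independent, so
    the per-task bounds multiply, and a union bound over the feature sets V gives
    Pr[bad] exp(eps n m / 3) <= |V| (x^-k (1+x)^(2m))^n; take x = eps / 8.
    Averaging over s' with the exponential weight replaces the usual "ghost sample is
    typical with probability 1/2" step, which would lose a constant factor that is
    not affordable when delta is close to 1. *)

(** * Shattering and the Sauer-Shelah bound in Pajor's form *)

Definition set_shatters (T : finType) (FF : {set {set T}}) (A : {set T}) : bool :=
  [forall B in powerset A, [exists X in FF, X :&: A == B]].

Lemma set_shattersP (T : finType) (FF : {set {set T}}) (A : {set T}) :
  reflect (forall B : {set T}, B \subset A -> exists2 X, X \in FF & X :&: A = B)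
          (set_shatters FF A).
Proof.
apply: (iffP forall_inP) => [sh B sBA | sh B].
  have /sh/exists_inP[X XF /eqP XA] : B \in powerset A by rewrite powersetE.
  by exists X.
rewrite powersetE => /sh[X XF XA].
by apply/exists_inP; exists X => //; apply/eqP.
Qed.

Lemma set_shattersS (T : finType) (FF GG : {set {set T}}) (A : {set T}) :
  FF \subset GG -> set_shatters FF A -> set_shatters GG A.
Proof.
move=> sFG /set_shattersP sh; apply/set_shattersP => B /sh[X XF XA].
by exists X => //; apply: (subsetP sFG).
Qed.

Lemma card_le_shattered (T : finType) (FF : {set {set T}}) :
  (#|FF| <= #|[set A | set_shatters FF A]|)%N.
Proof.
(* Split FF according to membership of a point x: a set A shattered by both halves
   yields two sets A and x |: A shattered by FF. *)
have [k] := ubnP #|FF|; elim: k FF => // k IHk FF /ltnSE lek.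
have [|] := leqP #|FF| 1.
  case: (set_0Vmem FF) => [-> _|[X XF] le1]; first by rewrite cards0.
  apply: leq_trans le1 _; apply/card_gt0P; exists set0; rewrite inE.
  apply/set_shattersP => B; rewrite subset0 => /eqP ->.
  by exists X => //; rewrite setI0.
case/card_gt1P => X [Y [XF YF neqXY]].
have [x xXY] : exists x, (x \in X) != (x \in Y).
  apply/existsP; move: neqXY; apply: contraR => /existsPn nx.
  by apply/eqP/setP => x; apply/eqP/negPn/nx.
pose F0 := [set Z in FF | x \notin Z]; pose F1 := [set Z in FF | x \in Z].
have [s0 s1] : F0 \subset FF /\ F1 \subset FF.
  by split; apply/subsetP => Z; rewrite inE => /andP[].
have cF : (#|F0| + #|F1| = #|FF|)%N.
  rewrite addnC -cardsUI; set I := F1 :&: F0.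
  have -> : I = set0 by apply/setP => Z; rewrite !inE; case: (x \in Z); rewrite !andbF.
  rewrite cards0 addn0; congr #|pred_of_set _|; apply/setP => Z; rewrite !inE -andb_orr.
  by rewrite orbN andbT.
have [F0p F1p] : (0 < #|F0|)%N /\ (0 < #|F1|)%N.
  move: xXY; case xX : (x \in X); case xY : (x \in Y) => // _; split; apply/card_gt0P;
  by [exists X; rewrite inE XF xX | exists Y; rewrite inE YF xY].
have /(IHk F0) h0 : (#|F0| < k)%N by lia.
have /(IHk F1) h1 : (#|F1| < k)%N by lia.
pose sh (G : {set {set T}}) := [set A | set_shatters G A].
(* A set shattered by one half cannot contain [x]: all members of a half agree at [x], so two traces
   differing there cannot both occur. *)
have x0 A : A \in sh F0 -> x \notin A.
  rewrite inE => /set_shattersP/(_ A (subxx _))[Z]; rewrite inE => /andP[_ xZ] <-.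
  by rewrite inE (negPf xZ).
have x1 A : A \in sh F1 -> x \notin A.
  rewrite inE => /set_shattersP/(_ set0 (sub0set _))[Z]; rewrite inE => /andP[_ xZ] /setP/(_ x).
  by rewrite !inE xZ /= => ->.
rewrite -cF; apply: leq_trans (leq_add h0 h1) _; rewrite -[X in (X <= _)%N]cardsUI.
rewrite -/(sh F0) -/(sh F1).
have <- : #|[set x |: A | A in sh F0 :&: sh F1]| = #|sh F0 :&: sh F1|.
  apply: card_in_imset => A B; rewrite !in_setI => /andP[/x0 xA _] /andP[/x0 xB _] eqAB.
  by rewrite -(setU1K xA) eqAB setU1K.
rewrite -cardsUI (_ : _ :&: [set _ | _ in _] = set0) ?cards0 ?addn0; last first.
  apply/setP => A; rewrite in_set0; apply/negP; rewrite in_setI => /andP[AU].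
  case/imsetP => B _ eqA; move: AU; rewrite in_setU => /orP[/x0|/x1];
  by rewrite eqA setU11.
apply/subset_leq_card/subsetP => A; rewrite in_setU => /orP[|].
  rewrite in_setU !inE => /orP[]; exact: set_shattersS.
case/imsetP => B; rewrite in_setI => /andP[B0 B1] ->.
have xB := x0 _ B0; move: B0 B1; rewrite !inE => /set_shattersP B0 /set_shattersP B1.
apply/set_shattersP => E sE.
have sE' : E :\ x \subset B by rewrite subDset.
(* The half is chosen by whether [E] contains [x]; a member cutting [E :\ x] out of [B] then cuts
   [E] out of [x |: B]. *)
have [xE|xE] := boolP (x \in E).
  have [Z] := B1 _ sE'; rewrite inE => /andP[ZF xZ] ZB; exists Z => //.
  by rewrite setIUr ZB (setIidPr _) ?sub1set // setD1K.
have [Z] := B0 _ sE'; rewrite inE => /andP[ZF xZ] ZB; exists Z => //.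
rewrite setIUr ZB (_ : Z :&: [set x] = set0) ?set0U.
  by apply/setDidPl; rewrite disjoint_sym disjoints1.
by apply/setP => y; rewrite !inE; case: eqP => [->|]; rewrite ?(negPf xZ) ?andbF.
Qed.

(** A set shattered by the traces on [X] is contained in [X], since it is itself a trace, and is
    shattered by [H]; Pajor's count of shattered sets therefore sees only small subsets of [X]. *)
Lemma card_restriction_le (T : finType) (H : {set {ffun T -> bool}}) (X : {set T}) :
  (#|[set [set x in X | h x] | h : {ffun T -> bool} in H]|
     <= #|[set A in powerset X | #|A| <= VC H]|)%N.
Proof.
apply: leq_trans (card_le_shattered _) _.
apply/subset_leq_card/subsetP => A; rewrite !inE => /set_shattersP sh.
have sAX : A \subset X.
  have [_ /imsetP[h _ ->] <-] := sh A (subxx _).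
  by apply/subsetP => y; rewrite !inE => /andP[/andP[]].
rewrite sAX /=; apply: (@leq_bigmax_cond _ _ (fun A : {set T} => #|A|)).
apply/forall_inP => B; rewrite powersetE => /sh[_ /imsetP[h hH ->] /setP eB].
apply/exists_inP; exists h => //; apply/forall_inP => y yA; rewrite -eB !inE yA.
by rewrite (subsetP sAX) // andbT.
Qed.

Lemma card_small_subsets_le (F : realFieldType) (T : finType) (X : {set T}) (k : nat) (x : F) :
  0 < x -> x <= 1 ->
  #|[set A in powerset X | (#|A| <= k)%N]|%:R <= x^-1 ^+ k * (1 + x) ^+ #|X|.
Proof.
move=> x0 x1.
(* Generating function of subsets by size. Points outside [X] get the factor 0 + 1, so subsets
   leaving [X] contribute 0. *)
have -> : (1 + x) ^+ #|X| = \sum_(A in powerset X) x ^+ #|A|.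
  rewrite -prodr_const big_mkcond [RHS]big_mkcond /=.
  transitivity (\prod_y ((if y \in X then x else 0) + 1)).
    by apply: eq_bigr => y _; case: ifP => _; rewrite ?add0r // addrC.
  rewrite bigA_distr; apply: eq_bigr => A _; rewrite powersetE.
  rewrite -big_mkcond /=; case: ifPn => [sAX|/subsetPn[y yA yX]].
    by rewrite -prodr_const; apply: eq_bigr => y yA; rewrite (subsetP sAX).
  by rewrite (bigD1 y) //= (negPf yX) mul0r.
(* The terms with #|A| <= k are each at least x ^+ k. *)
rewrite exprVn ler_pdivlMl ?exprn_gt0 // mulr_natr -sumr_const.
rewrite [X in _ <= X](bigID (fun A : {set T} => (#|A| <= k)%N)) /= ler_wpDr //.
  by apply: sumr_ge0 => A _; rewrite exprn_ge0 // ltW.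
under eq_bigl => A do rewrite inE.
by apply: ler_sum => A /andP[_ Ak]; apply: ler_wiXn2l => //; exact: ltW.
Qed.

(** * Error patterns and symmetrization by random swaps *)

Definition loss_pattern (hT Z : finType) (loss : hT -> Z -> bool) m
    (t : {ffun 'I_m -> Z * Z}) (h : hT) : {ffun 'I_m -> bool * bool} :=
  [ffun j => (loss h (t j).1, loss h (t j).2)].

Definition pattern_weight (F : realFieldType) m (w : {ffun 'I_m -> bool * bool}) : F :=
  \prod_(j < m) (2^-1 ^+ (w j).1 * (3 / 2) ^+ (w j).2).

Definition swap_at (X : finType) m (sigma : {ffun 'I_m -> bool})
    (t : {ffun 'I_m -> X * X}) : {ffun 'I_m -> X * X} :=
  [ffun j => if sigma j then ((t j).2, (t j).1) else t j].

Lemma swap_atK (X : finType) m (sigma : {ffun 'I_m -> bool}) :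
  involutive (@swap_at X m sigma).
Proof.
by move=> t; apply/ffunP => j; rewrite !ffunE; case: (sigma j) => //=; case: (t j).
Qed.

Lemma loss_pattern_swap (hT Z : finType) (loss : hT -> Z -> bool) m sigma
    (t : {ffun 'I_m -> Z * Z}) (h : hT) :
  loss_pattern loss (swap_at sigma t) h = swap_at sigma (loss_pattern loss t h).
Proof. by apply/ffunP => j; rewrite !ffunE; case: (sigma j). Qed.

Lemma pattern_weight_ge0 (F : realFieldType) m (w : {ffun 'I_m -> bool * bool}) :
  0 <= pattern_weight F w.
Proof. by apply: prodr_ge0 => j _; rewrite mulr_ge0 ?exprn_ge0 //; lra. Qed.

Lemma sum_pattern_weight_swap_le (F : realFieldType) m (w : {ffun 'I_m -> bool * bool}) :
  \sum_(sigma : {ffun 'I_m -> bool}) pattern_weight F (swap_at sigma w) <= 2 ^+ m.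
Proof.
pose wt (b : bool * bool) : F := 2^-1 ^+ b.1 * (3 / 2) ^+ b.2.
rewrite /pattern_weight; under eq_bigr => sigma _ do under eq_bigr => j _ do rewrite ffunE -/(wt _).
(* The sum over swaps factors by coordinate: each factor is 2, 1/2 + 3/2 or 3/4 + 3/4 for no, one or
   two errors. *)
rewrite -(bigA_distr_bigA (fun j b => wt (if b then ((w j).2, (w j).1) else w j))).
have -> : 2 ^+ m = \prod_(j < m) (2 : F) by rewrite prodr_const card_ord.
apply: ler_prod => j _; rewrite big_bool /= /wt.
by case: (w j) => -[] [] /=; rewrite ?expr1 ?expr0; apply/andP; split; lra.
Qed.

(** The law of the double sample is invariant under each swap, and a swap maps the pattern set of
    [t] onto that of the swapped sample. The expectation thus equals its average over all swaps,
    which is at most 1 per pattern. *)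
Lemma expected_weight_le (F : realFieldType) (hT Z : finType) (loss : hT -> Z -> bool)
    m (D : Z -> F) (H : {set hT}) (G : F) :
  (forall z, 0 <= D z) -> \sum_z D z = 1 ->
  (forall t : {ffun 'I_m -> Z * Z}, #|loss_pattern loss t @: H|%:R <= G) ->
  \sum_(t : {ffun 'I_m -> Z * Z}) (\prod_j (D (t j).1 * D (t j).2)) *
     \sum_(w in loss_pattern loss t @: H) pattern_weight F w <= G.
Proof.
move=> D0 D1 HG; set L := (X in X <= _).
pose E (t : {ffun 'I_m -> Z * Z}) := \prod_j (D (t j).1 * D (t j).2).
have E0 t : 0 <= E t by apply: prodr_ge0 => j _; rewrite mulr_ge0.
have E1 : \sum_t E t = 1.
  rewrite -(bigA_distr_bigA (fun (j : 'I_m) (z : Z * Z) => D z.1 * D z.2)).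
  apply: big1 => j _; rewrite -(pair_bigA _ (fun x y => D x * D y)) /=.
  by under eq_bigr => x _ do rewrite -mulr_sumr D1 mulr1.
have Lsw sigma : L = \sum_t E t *
    \sum_(w in loss_pattern loss t @: H) pattern_weight F (swap_at sigma w).
  rewrite /L (reindex_inj (inv_inj (swap_atK sigma))) /=.
  apply: eq_bigr => t _; congr (_ * _).
    by apply: eq_bigr => j _; rewrite ffunE; case: (sigma j) => //=; rewrite mulrC.
  have -> : loss_pattern loss (swap_at sigma t) @: H =
      swap_at sigma @: (loss_pattern loss t @: H).
    by rewrite -imset_comp; apply: eq_imset => h; apply: loss_pattern_swap.
  by rewrite big_imset //= => w w' _ _; apply: inv_inj; apply: swap_atK.
have p2 : 0 < (2 : F) ^+ m by rewrite exprn_gt0.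
rewrite -(ler_pM2r p2).
have -> : L * 2 ^+ m = \sum_(sigma : {ffun 'I_m -> bool}) L.
  by rewrite sumr_const card_ffun card_bool card_ord -natrX mulr_natr.
under eq_bigr => sigma _ do rewrite (Lsw sigma).
rewrite exchange_big /= (_ : G * _ = \sum_t E t * (G * 2 ^+ m)); last first.
  by rewrite -mulr_suml E1 mul1r.
apply: ler_sum => t _; rewrite -mulr_sumr ler_wpM2l // exchange_big /=.
apply: (@le_trans _ _ (\sum_(w in loss_pattern loss t @: H) 2 ^+ m)).
  by apply: ler_sum => w _; apply: sum_pattern_weight_swap_le.
by rewrite sumr_const -[X in X <= _]mulr_natl ler_wpM2r // ltW.
Qed.

(** Conditional expectation of the total pattern weight given the first half [s] of the double
    sample. *)
Definition ghost_weight (F : realFieldType) (hT Z : finType) (loss : hT -> Z -> bool)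
    m (D : Z -> F) (H : {set hT}) (s : {ffun 'I_m -> Z}) : F :=
  \sum_(s' : {ffun 'I_m -> Z}) (\prod_j D (s' j)) *
    \sum_(w in loss_pattern loss [ffun j => (s j, s' j)] @: H) pattern_weight F w.

Lemma ghost_weight_ge0 (F : realFieldType) (hT Z : finType) (loss : hT -> Z -> bool)
    m (D : Z -> F) (H : {set hT}) (s : {ffun 'I_m -> Z}) :
  (forall z, 0 <= D z) -> 0 <= ghost_weight loss D H s.
Proof.
move=> D0; apply: sumr_ge0 => s' _; apply: mulr_ge0; first exact: prodr_ge0.
by apply: sumr_ge0 => w _; apply: pattern_weight_ge0.
Qed.

Lemma expected_ghost_weight_le (F : realFieldType) (hT Z : finType)
    (loss : hT -> Z -> bool) m (D : Z -> F) (H : {set hT}) (G : F) :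
  (forall z, 0 <= D z) -> \sum_z D z = 1 ->
  (forall t : {ffun 'I_m -> Z * Z}, #|loss_pattern loss t @: H|%:R <= G) ->
  \sum_(s : {ffun 'I_m -> Z}) (\prod_j D (s j)) * ghost_weight loss D H s <= G.
Proof.
move=> D0 D1 HG; apply: le_trans (expected_weight_le D0 D1 HG); rewrite le_eqVlt.
apply/orP; left; apply/eqP.
pose zip_ (p : {ffun 'I_m -> Z} * {ffun 'I_m -> Z}) := [ffun j => (p.1 j, p.2 j)].
rewrite [RHS](reindex zip_); last first.
  exists (fun t : {ffun 'I_m -> Z * Z} => ([ffun j => (t j).1], [ffun j => (t j).2])).
    by move=> [s s'] _ /=; congr (_, _); apply/ffunP => j; rewrite !ffunE.
  by move=> t _; apply/ffunP => j; rewrite !ffunE /= ?ffunE; case: (t j).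
rewrite -(pair_bigA _ (fun s s' => (\prod_j (D (zip_ (s, s') j).1 * D (zip_ (s, s') j).2)) *
  \sum_(w in loss_pattern loss (zip_ (s, s')) @: H) pattern_weight F w)) /=.
apply: eq_bigr => s _; rewrite /ghost_weight mulr_sumr.
apply: eq_bigr => s' _; rewrite mulrA -big_split /=.
by congr (_ * _); apply: eq_bigr => j _; rewrite /zip_ ffunE.
Qed.

(** Only the pattern of [h] is kept in the sum. The ghost examples are independent, and
    [(3 / 2) ^+ loss] averages to 1 plus half the true error. *)
Lemma ghost_weight_ge (F : realFieldType) (hT Z : finType) (loss : hT -> Z -> bool)
    m (D : Z -> F) (H : {set hT}) (h : hT) (s : {ffun 'I_m -> Z}) :
  (forall z, 0 <= D z) -> \sum_z D z = 1 -> h \in H ->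
  \prod_(j < m) (2^-1 ^+ loss h (s j) * (1 + (\sum_z D z * (loss h z)%:R) / 2))
    <= ghost_weight loss D H s.
Proof.
move=> D0 D1 hH.
have e z : D z * (3 / 2) ^+ loss h z = D z + D z * (loss h z)%:R / 2.
  by case: (loss h z); rewrite /= ?expr1 ?expr0; lra.
have -> : 1 + (\sum_z D z * (loss h z)%:R) / 2 = \sum_z D z * (3 / 2) ^+ loss h z.
  by rewrite (eq_bigr _ (fun z _ => e z)) big_split /= D1 -mulr_suml.
under eq_bigr => j _ do rewrite mulr_sumr.
rewrite bigA_distr_bigA; apply: ler_sum => s' _.
under eq_bigr => j _ do rewrite mulrCA.
rewrite big_split /= ler_wpM2l //; first exact: prodr_ge0.
rewrite (bigD1 (loss_pattern loss [ffun j => (s j, s' j)] h)) /=; last exact: imset_f.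
rewrite ler_wpDr //; first by apply: sumr_ge0 => w _; apply: pattern_weight_ge0.
rewrite le_eqVlt; apply/orP; left; apply/eqP.
by apply: eq_bigr => j _; rewrite !ffunE.
Qed.

(** * Pattern counts for classifiers and the union bound over feature sets *)

Definition zero_one_loss d (h : hyp d) (z : point d * bool) : bool := h z.1 != z.2.

(** A pattern is determined by the trace of [h] on the at most [2 * m] sample points. Allowing any
    [k] above the VC dimension gives one bound valid for all feature sets. *)
Lemma card_loss_pattern_le (F : realFieldType) d m (H : {set hyp d})
    (t : {ffun 'I_m -> (point d * bool) * (point d * bool)}) (k : nat) (x : F) :
  0 < x -> x <= 1 -> (VC H <= k)%N ->
  #|loss_pattern (@zero_one_loss d) t @: H|%:R <= x^-1 ^+ k * (1 + x) ^+ (2 * m).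
Proof.
move=> x0 x1 Hk.
pose X := [set (t j).1.1 | j : 'I_m] :|: [set (t j).2.1 | j : 'I_m].
have cX : (#|X| <= 2 * m)%N.
  rewrite mul2n -addnn -[m in X in (_ <= X)%N]card_ord; apply: leq_trans (leq_card_setU _ _) _.
  by apply: leq_add; apply: leq_imset_card.
pose g (B : {set point d}) : {ffun 'I_m -> bool * bool} :=
  [ffun j => (((t j).1.1 \in B) != (t j).1.2, ((t j).2.1 \in B) != (t j).2.2)].
have -> : loss_pattern (@zero_one_loss d) t @: H =
    g @: [set [set y in X | h y] | h : hyp d in H].
  rewrite -imset_comp; apply: eq_imset => h; apply/ffunP => j; rewrite !ffunE /= /zero_one_loss.
  have X1 : (t j).1.1 \in X by rewrite in_setU; apply/orP; left; apply/imsetP; exists j.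
  have X2 : (t j).2.1 \in X by rewrite in_setU; apply/orP; right; apply/imsetP; exists j.
  have memX y : y \in X -> (y \in [set y in X | h y]) = h y by move=> yX; rewrite in_set yX.
  by rewrite !memX.
apply: (@le_trans _ _ (x^-1 ^+ VC H * (1 + x) ^+ #|X|)).
  apply: le_trans (card_small_subsets_le X (VC H) x0 x1); rewrite ler_nat.
  exact: leq_trans (leq_imset_card _ _) (card_restriction_le _ _).
have x0' := ltW x0.
apply: ler_pM; rewrite ?exprn_ge0 ?invr_ge0 ?addr_ge0 //.
  by rewrite ler_weXn2l // invf_ge1.
by rewrite ler_weXn2l // lerDl.
Qed.

(** Markov's inequality. On a bad sample, let [V] be the union of the relevant sets of [h]: every
    [h i] lies in [restrictC C V], so the product of ghost weights for this [V] is at least [K].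
    Summing over [V] is the union bound, and independence of the tasks makes the expected product a
    product of expectations. *)
Lemma delta_gen_D_le d n m (C : {set hyp d}) (calV : {set {set 'I_d}}) (eps : R)
    (D : 'I_n -> {ffun (point d * bool) -> R}) (G K : R) :
  (forall i, is_distr (D i)) -> 0 <= G ->
  (forall V (t : {ffun 'I_m -> (point d * bool) * (point d * bool)}), V \in calV ->
     #|loss_pattern (@zero_one_loss d) t @: restrictC C V|%:R <= G) ->
  (forall (h : 'I_n -> hyp d) (S : samples d n m),
     emp_err h S <= eps -> 4 * eps <= true_err D h ->
     K <= \prod_(i < n) \prod_(j < m) (2^-1 ^+ zero_one_loss (h i) (S i j) *
            (1 + (\sum_z D i z * (zero_one_loss (h i) z)%:R) / 2))) ->
  delta_gen_D m C calV eps D * K <= #|calV|%:R * G ^+ n.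
Proof.
move=> distrD G0 patG lbK.
have D0 i z : 0 <= D i z by have [] := distrD i.
have D1 i : \sum_z D i z = 1 by have [] := distrD i.
pose Q V i (s : {ffun 'I_m -> point d * bool}) :=
  ghost_weight (@zero_one_loss d) (D i) (restrictC C V) s.
have Q0 V i s : 0 <= Q V i s by apply: ghost_weight_ge0.
have P0 (S : samples d n m) : 0 <= sample_prob D S.
  by apply: prodr_ge0 => i _; apply: prodr_ge0.
have T0 (S : samples d n m) : 0 <= \sum_(V in calV) \prod_(i < n) Q V i (S i).
  by apply: sumr_ge0 => V _; apply: prodr_ge0.
apply: (@le_trans _ _ (\sum_(S : samples d n m)
    sample_prob D S * \sum_(V in calV) \prod_(i < n) Q V i (S i))).
  rewrite /delta_gen_D mulr_suml.
  rewrite [X in _ <= X](bigID (bad_event C calV eps D)) /= ler_wpDr //.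
    by apply: sumr_ge0 => S _; rewrite mulr_ge0.
  apply: ler_sum => S /existsP[h /and4P[/forallP hC hV hemp htrue]].
  rewrite ler_wpM2l // (bigD1 _ hV) /= ler_wpDr //.
    by apply: sumr_ge0 => V _; apply: prodr_ge0.
  apply: le_trans (lbK _ _ hemp htrue) _; apply: ler_prod => i _; apply/andP; split.
    apply: prodr_ge0 => j _; rewrite mulr_ge0 ?exprn_ge0 ?invr_ge0 ?addr_ge0 ?divr_ge0 //.
    by apply: sumr_ge0 => z _; rewrite mulr_ge0.
  apply: ghost_weight_ge => //; rewrite inE hC /=; exact: (bigcup_sup i).
under eq_bigr => S _ do rewrite mulr_sumr.
rewrite exchange_big /= mulr_natl -sumr_const; apply: ler_sum => V VV.
under eq_bigr => S _ do rewrite /sample_prob -big_split /=.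
rewrite -(bigA_distr_bigA (fun i (s : {ffun 'I_m -> point d * bool}) =>
  (\prod_(j < m) D i (s j)) * Q V i s)) /=.
have -> : G ^+ n = \prod_(i < n) G by rewrite prodr_const card_ord.
apply: ler_prod => i _; apply/andP; split.
  by apply: sumr_ge0 => s _; rewrite mulr_ge0 // prodr_ge0.
by apply: expected_ghost_weight_le => // t; apply: patG.
Qed.

(** * Exponential estimates *)

Lemma exp_ge1Dx (x : R) : 1 + x <= exp x.
Proof. exact/RleP/exp_ineq1_le. Qed.

Lemma exp_mul (x y : R) : exp x * exp y = exp (x + y).
Proof. exact: expRD. Qed.

Lemma exp_gt0 (x : R) : 0 < exp x.
Proof. exact/RltP/exp_pos. Qed.

Lemma ler_exp (x y : R) : x <= y -> exp x <= exp y.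
Proof.
rewrite le_eqVlt => /orP[/eqP -> //|/RltP xy]; apply/ltW/RltP; exact: exp_increasing.
Qed.

Lemma exp_lnK (x : R) : 0 < x -> exp (Rpower.ln x) = x.
Proof. by move=> /RltP; apply: exp_ln. Qed.

Lemma exp_sum (I : finType) (f : I -> R) : \prod_i exp (f i) = exp (\sum_i f i).
Proof.
by elim/big_ind2: _ => [|x a y b -> ->|] //; rewrite ?exp_mul ?expR0.
Qed.

(** From [1 - x / 3 <= exp (- (x / 3))] and (1 + x/2)(1 - x/3) = 1 + x(1 - x)/6, which is at least 1
    on [0,1]. *)
Lemma exp_third_le (x : R) : 0 <= x -> x <= 1 -> exp (x / 3) <= 1 + x / 2.
Proof.
move=> x0 x1; have := exp_ge1Dx (- (x / 3)); have := exp_mul (x / 3) (- (x / 3)).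
rewrite subrr expR0; have := exp_gt0 (x / 3).
move: (exp _) (exp _) => a b a0 ab hb; nra.
Qed.

Lemma exp_loss_le (b : bool) : exp (- b%:R) <= 2^-1 ^+ b.
Proof.
case: b; rewrite ?oppr0 ?expR0 // expr1; have := exp_ge1Dx 1; have := exp_mul 1 (- 1).
rewrite subrr expR0; have := exp_gt0 1.
by move: (exp _) (exp _) => a b a0 ab hb; nra.
Qed.

(** The exponent is at least -eps n m + (4 eps n m)/3 = eps n m / 3: the factor 4 between the two
    error levels must beat the 3 lost in [exp_third_le]. *)
Lemma exp_error_gap_le d n m (eps : R) (D : 'I_n -> {ffun (point d * bool) -> R})
    (h : 'I_n -> hyp d) (S : samples d n m) :
  (forall i, is_distr (D i)) -> (0 < n * m)%N ->
  emp_err h S <= eps -> 4 * eps <= true_err D h ->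
  exp (eps * (n * m)%:R / 3) <=
    \prod_(i < n) \prod_(j < m) (2^-1 ^+ zero_one_loss (h i) (S i j) *
      (1 + (\sum_z D i z * (zero_one_loss (h i) z)%:R) / 2)).
Proof.
move=> distrD nm0 hemp htrue.
pose q i : R := \sum_z D i z * (zero_one_loss (h i) z)%:R.
have q01 i : 0 <= q i <= 1.
  have [D0 D1] := distrD i; apply/andP; split.
    by apply: sumr_ge0 => z _; rewrite mulr_ge0.
  by rewrite -D1; apply: ler_sum => z _; rewrite ler_piMr // lern1 leq_b1.
apply: (@le_trans _ _ (\prod_(i < n) \prod_(j < m)
    exp (- (zero_one_loss (h i) (S i j))%:R + q i / 3))); last first.
  apply: ler_prod => i _; apply/andP; split.
    by apply: prodr_ge0 => j _; apply/ltW/exp_gt0.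
  apply: ler_prod => j _; rewrite ltW ?exp_gt0 //= -exp_mul.
  have /andP[q0 q1] := q01 i.
  apply: ler_pM; [exact/ltW/exp_gt0 | exact/ltW/exp_gt0 | exact: exp_loss_le |].
  exact: exp_third_le.
under eq_bigr => i _ do rewrite exp_sum big_split /= sumrN sumr_const card_ord.
rewrite exp_sum big_split /= sumrN; apply: ler_exp.
rewrite sumrMnl -mulr_suml.
have [n0 m0] : (0 : R) < n%:R /\ (0 : R) < m%:R.
  by move: nm0; rewrite muln_gt0 !ltr0n => /andP.
have nm0' : (0 : R) < (n * m)%:R by rewrite ltr0n.
move: hemp htrue; rewrite /emp_err /true_err ler_pdivrMl // ler_pdivlMl //.
rewrite -/(zero_one_loss _ _).
set A := \sum_(i < n) _; set B := \sum_(i < n) _; rewrite natrM => hA hB.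
rewrite -/A -/B -[X in _ <= _ + X]mulr_natl; have := ler_wpM2l (ltW m0) hB; lra.
Qed.

(** Since [eps^-1] is at least 2, 8/eps is at most the fourth power of [eps^-1], that is
    [exp (4 * L)]; the other factor uses 1 + eps/8 <= exp(eps/8). *)
Lemma growth_le_exp (eps L : R) (k m : nat) :
  0 < eps -> eps < 1 / 2 -> exp L = eps^-1 ->
  (eps / 8)^-1 ^+ k * (1 + eps / 8) ^+ (2 * m) <= exp (4 * k%:R * L + m%:R * eps / 4).
Proof.
move=> e0 e1 eL; rewrite -exp_mul; apply: ler_pM.
- by rewrite exprn_ge0 // invr_ge0; lra.
- by rewrite exprn_ge0 //; lra.
- rewrite (_ : 4 * k%:R * L = L *+ 4 *+ k); last by rewrite -[RHS]mulr_natl -[L *+ 4]mulr_natl; lra.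
  rewrite -!expRX eL lerXn2r ?nnegrE ?exprn_ge0 ?invr_ge0 //; [lra | exact: ltW |].
  have : 2 <= eps^-1 by rewrite -[2]invrK lef_pV2 ?posrE //; lra.
  rewrite invfM invrK; move: (eps^-1) => y y2.
  have y4 : 4 <= y ^+ 2 by nra.
  have : 8 <= y ^+ 3 by rewrite exprS; nra.
  by rewrite [y ^+ 4]exprS; nra.
- rewrite (_ : m%:R * eps / 4 = (eps / 8) *+ (2 * m)); last by rewrite -[RHS]mulr_natl natrM; lra.
  rewrite -expRX lerXn2r ?nnegrE ?exp_ge1Dx //; last exact/ltW/exp_gt0.
  by lra.
Qed.

Theorem mainTheorem5 :
  exists c : R, 0 < c /\
  forall (d : nat) (C : {set hyp d}) (calV : {set {set 'I_d}}) (eps delta : R)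
         (n m : nat),
    calV != set0 ->
    0 < eps -> eps < 1 / 2 ->
    0 < delta -> delta < 1 ->
    c * (VCcond C calV)%:R * Rpower.ln (eps^-1) / eps <= m%:R ->
    c * (Rpower.ln (#|calV|%:R) + Rpower.ln (delta^-1)) / eps <= (n * m)%:R ->
    forall D : 'I_n -> {ffun (point d * bool) -> R},
      (forall i, is_distr (D i)) ->
      delta_gen_D m C calV eps D <= delta.
Proof.
(* The exponents leave a margin eps n m (1/3 - 1/4) = eps n m / 12. With 60, the VC term 4 n k L
   costs at most eps n m / 15 and [LV + Ld] at most eps n m / 60, which add up to exactly 1/12. *)
exists 60; split=> // d C calV eps delta n m calV0 e0 e1 d0 d1.
have cV : (1 : R) <= #|calV|%:R by rewrite ler1n card_gt0.
have cV0 : (0 : R) < #|calV|%:R by apply: lt_le_trans cV.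
have eL := exp_lnK _; have := eL eps^-1; have := eL delta^-1; have := eL _ cV0.
rewrite !invr_gt0 => eV /(_ d0) ed /(_ e0) ee {eL}.
set L := ln eps^-1 in ee *; set Ld := ln delta^-1 in ed *; set LV := ln _ in eV *.
rewrite !ler_pdivrMr // => hm hnm D distrD.
have LV0 : 0 <= LV.
  rewrite leNgt; apply/negP => lt0; have := exp_ge1Dx (- LV); have := exp_mul LV (- LV).
  by rewrite subrr expR0 eV; move: (exp _) => y; nra.
have Ld0 : 0 < Ld.
  rewrite ltNge; apply/negP => /ler_exp; rewrite ed expR0 => le1.
  by move: d1; rewrite -invf_gt1 // ltNge le1.
(* Strict positivity of [Ld], from [delta < 1], excludes an empty sample, for which [emp_err] would
   be 0 by the convention on inverses. *)
have nm0 : (0 < n * m)%N.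
  rewrite -(ltr0n R); have : 0 < (n * m)%:R * eps by lra.
  by rewrite pmulr_lgt0.
have VCk V : V \in calV -> (VC (restrictC C V) <= VCcond C calV)%N.
  by move=> VV; apply: (@leq_bigmax_cond _ _ (fun V => VC (restrictC C V))).
set k := VCcond C calV in hm VCk.
pose G := (eps / 8)^-1 ^+ k * (1 + eps / 8) ^+ (2 * m).
have G0 : 0 <= G.
  by rewrite mulr_ge0 ?exprn_ge0 ?invr_ge0 //; lra.
have patG V (t : {ffun 'I_m -> (point d * bool) * (point d * bool)}) : V \in calV ->
    #|loss_pattern (@zero_one_loss d) t @: restrictC C V|%:R <= G.
  by move=> /VCk; apply: card_loss_pattern_le; lra.
have := delta_gen_D_le distrD G0 patG
  (fun h S => @exp_error_gap_le d n m eps D h S distrD nm0).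
have GE : G ^+ n <= exp ((4 * k%:R * L + m%:R * eps / 4) *+ n).
  rewrite -expRX lerXn2r ?nnegrE //; first exact/ltW/exp_gt0.
  exact: growth_le_exp.
have -> : delta = exp (- Ld).
  by apply: (mulIf (lt0r_neq0 (exp_gt0 Ld))); rewrite exp_mul addNr expR0 ed mulfV ?gt_eqF.
move=> bound; rewrite -(ler_pM2r (exp_gt0 (eps * (n * m)%:R / 3))) exp_mul.
apply: (le_trans bound).
rewrite -eV; apply: (@le_trans _ _ (exp (LV + (4 * k%:R * L + m%:R * eps / 4) *+ n))).
  by rewrite -exp_mul ler_wpM2l // ltW // exp_gt0.
apply: ler_exp; rewrite -mulr_natl.
have := ler_wpM2l (ler0n R n) hm; move: hnm; rewrite natrM; lra.
Qed.
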